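(* The midpoint rule $$x_{n+1} = x_n + h f(\bar x),\qquad \bar x = \tfrac12 (x_n + x_{n+1}),$$ is a (weakly) contractive integrator in two dimensions, i.e. for ODEs $\dot x = f(x)$ with $x\in\mathbb{R}^2$.
   Context: Consider ODEs $\dot x = f(x)$, $x\in\mathbb{R}^n$, with $f$ continuously differentiable, and write $F(x)=df(x)$ for the derivative (Jacobian matrix) of the vector field $f$. A one-step method with time step $h$ is written $x_{n+1}=g(x_n)$ and its Jacobian at the point $x$ is $A=dg(x)$. The ODE is called (weakly) contractive if $\operatorname{tr}F(x)\le 0$ for all $x$. An integrator (one-step method) is called (weakly) contractive in dimension $n$ if for any matrix norm $\|\cdot\|$ and all $L>0$ there is $h^*>0$ (depending on the norm and on $L$, but not on $f$, $x$ or $h$) such that $|\det A|\le 1$ for all $0<h<h^*$, for all $x\in\mathbb{R}^n$, and for all $f$ such that $\|F(x)\|<L$ and $\operatorname{tr}F(x)\le 0$ for all $x$. For implicit methods, $h^*$ is taken small enough that for $0<h<h^*$ the defining equations determine $x_{n+1}$ uniquely as a differentiable function of $x_n$. *)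

(* Defs.v *)
From HB Require Import structures.
From mathcomp Require Import all_boot all_order all_algebra.
From mathcomp Require Import boolp classical_sets functions reals topology.
From mathcomp Require Import normedtype derive.
Set Implicit Arguments.
Unset Strict Implicit.
Unset Printing Implicit Defensive.
Import Order.TTheory GRing.Theory Num.Theory.
Import numFieldNormedType.Exports.
Local Open Scope classical_set_scope.
Local Open Scope ring_scope.

(* Points of R^n are row vectors, and [jacobian f x] acts on them from the
   right ('d f x v = v *m jacobian f x); the transpose gives the usual matrix
   with entry (i, j) equal to the j-th partial derivative of the i-th
   component of f. *)
Definition Dmx (R : realType) (n : nat) (f : 'rV[R]_n -> 'rV[R]_n)
    (x : 'rV[R]_n) : 'M[R]_n :=
  (jacobian f x)^T.

Definition C1 (R : realType) (n : nat) (f : 'rV[R]_n -> 'rV[R]_n) : Prop :=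
  (forall x, differentiable f x) /\ continuous (Dmx f).

(* A norm on the vector space of matrices. Submultiplicativity is not
   required, so operator norms and entrywise norms are all covered. *)
Definition matrix_norm (R : realType) (n : nat) (N : 'M[R]_n -> R) : Prop :=
  [/\ forall A, 0 <= N A,
      forall A, N A = 0 -> A = 0,
      forall (c : R) A, N (c *: A) = `|c| * N A
    & forall A B, N (A + B) <= N A + N B].

Definition contractive_ode (R : realType) (n : nat)
    (f : 'rV[R]_n -> 'rV[R]_n) : Prop :=
  forall x, \tr (Dmx f x) <= 0.

(* A possibly implicit one-step method is given by its defining equation:
   [Phi h f x y] says that y is an admissible successor of x, for the step h
   and the vector field f. *)
Definition one_step_method (R : realType) (n : nat) : Type :=
  R -> ('rV[R]_n -> 'rV[R]_n) -> 'rV[R]_n -> 'rV[R]_n -> Prop.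

(* The defining equation has exactly one solution y = g x for every x, and
   g is differentiable. *)
Definition determines (R : realType) (n : nat) (Phi : one_step_method R n)
    (h : R) (f g : 'rV[R]_n -> 'rV[R]_n) : Prop :=
  (forall x y, Phi h f x y <-> y = g x) /\ (forall x, differentiable g x).

Definition contractive_integrator (R : realType) (n : nat)
    (Phi : one_step_method R n) : Prop :=
  forall N : 'M[R]_n -> R, matrix_norm N ->
  forall L : R, 0 < L ->
  exists hstar : R, 0 < hstar /\
    forall h : R, 0 < h -> h < hstar ->
    forall f : 'rV[R]_n -> 'rV[R]_n,
      C1 f -> (forall x, N (Dmx f x) < L) -> contractive_ode f ->
      exists g : 'rV[R]_n -> 'rV[R]_n,
        determines Phi h f g /\ forall x, `|\det (Dmx g x)| <= 1.

Definition midpoint_rule (R : realType) (n : nat) : one_step_method R n :=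
  fun h f x y => y = x + h *: f (2^-1 *: (x + y)).

(* Main.v *)
(* Writing s = h/2, the midpoint u solves u = x + s f(u). By the mean value
   inequality the right-hand side is a contraction for small s, so u = k(x) is
   unique and Lipschitz in x; k inverts u |-> u - s f(u), hence is
   differentiable, and g = 2k - id. With J the Jacobian of f at k(x), this gives
   Dg = (1 - sJ)^-1 (1 + sJ). In dimension 2, det (1 +- sJ) =
   1 + s^2 det J +- s tr J; the common part is positive for small s, so
   tr J <= 0 gives |det (1 + sJ)| <= det (1 - sJ). *)
From HB Require Import structures.
Require Import Defs.
From mathcomp Require Import all_boot all_order all_algebra.
From mathcomp Require Import interval_inference boolp classical_sets functions.
From mathcomp Require Import reals topology normedtype landau sequences derive.
From mathcomp Require Import ring lra.

Set Implicit Arguments.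
Unset Strict Implicit.
Unset Printing Implicit Defensive.
Import Order.TTheory GRing.Theory Num.Theory.
Import numFieldNormedType.Exports.
Local Open Scope classical_set_scope.
Local Open Scope ring_scope.

(* The library has completeness and the norm of matrices only separately. *)
HB.instance Definition _ (R : realType) m n :=
  Uniform_isComplete.Build 'M[R]_(m, n) cauchy_cvg.

(** * Sup-norm estimates for matrices *)

Lemma mx_entry_le_norm (R : realType) m n (A : 'M[R]_(m, n)) i j :
  `|A i j| <= `|A|.
Proof.
rewrite [leRHS]/Num.norm /= mx_normrE.
by apply/bigmax_geP; right => /=; exists (i, j).
Qed.

Lemma mx_norm_le (R : realType) m n (A : 'M[R]_(m, n)) (M : R) :
  0 <= M -> (forall i j, `|A i j| <= M) -> `|A| <= M.
Proof.
move=> M0 AM; rewrite [leLHS]/Num.norm /= mx_normrE.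
by apply/bigmax_leP; split => // -[i j] _; exact: AM.
Qed.

Lemma rV_mulmx_norm_le (R : realType) m n (v : 'rV[R]_m) (A : 'M[R]_(m, n)) :
  `|v *m A| <= m%:R * `|A| * `|v|.
Proof.
apply: mx_norm_le => [|i j]; first by rewrite !mulr_ge0.
rewrite mxE (le_trans (ler_norm_sum _ _ _))//.
rewrite -mulrA mulr_natl -[X in _ *+ X]card_ord -sumr_const ler_sum// => k _.
by rewrite normrM mulrC ler_pM// mx_entry_le_norm.
Qed.

Lemma mulmxr_continuous (R : realType) m n (A : 'M[R]_(m, n)) :
  continuous (mulmxr A : 'rV[R]_m -> 'rV[R]_n).
Proof.
apply/bounded_linear_continuous/bounded_funP => r; exists (m%:R * `|A| * r).
move=> v vr /=; rewrite (le_trans (rV_mulmx_norm_le _ _))//.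
by rewrite ler_wpM2l// mulr_ge0.
Qed.

(** * Comparison of an arbitrary matrix norm with the sup norm *)

Section matrix_norm.
Context {R : realType} {n : nat} {N : 'M[R]_n -> R}.
Hypothesis normN : matrix_norm N.

Lemma matrix_norm_upper_bound (A : 'M[R]_n) :
  N A <= (\sum_i \sum_j N (delta_mx i j)) * `|A|.
Proof.
have [N0 _ NZ ND] := normN.
have Nsum (F : 'I_n -> 'M[R]_n) : N (\sum_i F i) <= \sum_i N (F i).
  apply: (big_ind2 (fun B x => N B <= x)) => // [|B x C y Bx Cy].
    by rewrite -(scale0r 0) NZ normr0 mul0r.
  by rewrite (le_trans (ND _ _))// lerD.
rewrite {1}[A]matrix_sum_delta mulr_suml (le_trans (Nsum _))// ler_sum// => i _.
rewrite mulr_suml (le_trans (Nsum _))// ler_sum// => j _.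
by rewrite NZ mulrC ler_wpM2l// mx_entry_le_norm.
Qed.

Lemma matrix_norm_dist_le (A B : 'M[R]_n) :
  `|N A - N B| <= (\sum_i \sum_j N (delta_mx i j)) * `|A - B|.
Proof.
have [_ _ _ ND] := normN.
have le C D : N C - N D <= (\sum_i \sum_j N (delta_mx i j)) * `|C - D|.
  rewrite (le_trans _ (matrix_norm_upper_bound _))// lerBlDr.
  by rewrite -{1}(subrK D C) ND.
by rewrite ler_norml le andbT lerNl opprB distrC le.
Qed.

(** Equivalence of norms in finite dimension: [N] is Lipschitz for the sup norm, hence attains a
    positive minimum on the compact unit sphere. The constant is the inverse of that minimum, and
    homogeneity carries the bound to all matrices. *)
Lemma matrix_norm_entry_bound :
  exists2 c : R, 0 < c & forall (A : 'M_n) i j, `|A i j| <= c * N A.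
Proof.
have [N0 Nsep NZ _] := normN.
(* The sphere lives among row vectors, where closed bounded sets are compact; [vec_mx] carries it to
   matrices. *)
pose S := [set v : 'rV[R]_(n * n) | `|v| = 1].
have Scompact : compact S.
  apply: bounded_closed_compact.
    by exists 1; split => // x /ltW x1 v /= ->.
  rewrite (_ : S = Num.norm @^-1` [set 1])//.
  apply: preimage_closed => [v _|]; first exact: norm_continuous.
  exact: closed_eq.
have Ncont : continuous (N \o vec_mx : 'rV[R]_(n * n) -> R).
  move=> v; apply/(@cvgrPdist_lt _ _ _ (nbhs v)) => e e0.
  set C := \sum_i \sum_j N (delta_mx i j).
  have C0 : 0 <= C by rewrite sumr_ge0// => i _; rewrite sumr_ge0.
  (* [C] may be zero, so the division below uses [C + 1]. *)
  have C1 : 0 < C + 1 by rewrite ltr_wpDl.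
  near=> w => /=.
  rewrite (le_lt_trans (matrix_norm_dist_le _ _))// -/C.
  have vw : `|vec_mx v - vec_mx w| <= `|v - w|.
    rewrite -raddfB; apply: mx_norm_le => // i j; rewrite mxE.
    exact: mx_entry_le_norm.
  rewrite (@le_lt_trans _ _ ((C + 1) * `|v - w|))//.
    by rewrite ler_pM// lerDl.
  rewrite -ltr_pdivlMl// mulrC.
  by near: w; apply: cvgr_dist_lt => //; rewrite divr_gt0.
have mxvec0 (A : 'M[R]_n) : (mxvec A == 0) = (A == 0).
  by rewrite -[RHS](inj_eq (can_inj mxvecK)) linear0.
have mxvecS A : A != 0 -> S (`|mxvec A|^-1 *: mxvec A).
  by move=> A0; rewrite /S /= normrZ normfV normr_id mulVf// normr_eq0 mxvec0.
(* An empty sphere forces every matrix to be zero, as happens for [n = 0]; any positive constant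
   then serves. *)
have [S0|/set0P/negP/negPn/eqP S0] := pselect (S !=set0); last first.
  exists 1 => // A i j; have [->|/mxvecS] := eqVneq A 0.
    by rewrite mxE normr0 mulr_ge0.
  by rewrite S0.
have [v Sv vmin] := compact_EVT_min S0 Scompact (continuous_subspaceT Ncont).
have Nv : 0 < N (vec_mx v).
  rewrite lt_def N0 andbT; apply/eqP => /Nsep /(congr1 mxvec).
  rewrite vec_mxK linear0 => v0.
  by move: Sv; rewrite inE /S/= v0 normr0 => /esym/eqP; rewrite oner_eq0.
exists (N (vec_mx v))^-1 => [|A i j]; first by rewrite invr_gt0.
have [->|A0] := eqVneq A 0; first by rewrite mxE normr0 mulr_ge0// invr_ge0.
have vA0 : 0 < `|mxvec A|.
  by rewrite normr_gt0 mxvec0.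
have := vmin _ (mem_set (mxvecS _ A0)).
rewrite /= linearZ/= mxvecK NZ normfV normr_id => le1.
rewrite ler_pdivlMl//.
rewrite (le_trans (ler_wpM2l _ (_ : _ <= `|mxvec A|)))//.
- by rewrite -mxvecE mx_entry_le_norm.
- by rewrite mulrC -ler_pdivlMl.
Unshelve. all: by end_near. Qed.

End matrix_norm.

(** The mean value theorem is applied to each component of [f] along the segment from [y] to [x].
    The factor [m] counts the terms in each entry of a row vector times the Jacobian. *)
Lemma lipschitz_jacobian_bound (R : realType) m n
    (f : 'rV[R]_m -> 'rV[R]_n) (K : R) :
  (forall x, differentiable f x) -> (forall x, `|jacobian f x| <= K) ->
  forall x y, `|f x - f y| <= m%:R * K * `|x - y|.
Proof.
move=> df JK x y.
have K0 : 0 <= K by apply: le_trans (JK 0).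
apply: mx_norm_le => [|i j]; first by rewrite !mulr_ge0.
rewrite ord1 {i} !mxE.
set v := x - y.
pose p : R -> 'rV[R]_m := cst y + *:%R^~ v.
have dp t : is_diff t p (0 + *:%R^~ v) by exact: is_diffD.
have dfp (t : R) : is_derive t (1 : R) (fun s => f (p s) 0 j)
    ((v *m jacobian f (p t)) 0 j).
  have dcomp : differentiable (f \o p) t by exact: differentiable_comp.
  have dd : derivable (f \o p) t 1 by exact: diff_derivable.
  apply: DeriveDef; first by move/derivable_mxP : dd; exact.
  have := derive_mx dd => /(congr1 (fun A : 'rV[R]_n => A 0 j)).
  rewrite mxE => <-.
  rewrite deriveE// diff_comp//= diff_val !fctE add0r scale1r.
  by rewrite -deriveE// deriveEjacobian.
have [t _] := MVT_segment ler01 (fun t _ => dfp t)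
  (derivable_within_continuous (fun t _ => @ex_derive _ _ _ _ _ _ _ (dfp t))).
have -> : p 1 = x by rewrite /p !fctE scale1r addrC subrK.
have -> : p 0 = y by rewrite /p !fctE scale0r addr0.
rewrite subr0 mulr1 => ->.
rewrite (le_trans (mx_entry_le_norm _ _ _))//.
rewrite (le_trans (rV_mulmx_norm_le _ _))//.
by rewrite ler_wpM2r// ler_wpM2l.
Qed.

Lemma contraction_unique_fixpoint (R : realType) (V : completeNormedModType R)
    (f : V -> V) (q : R) :
  q < 1 -> (forall x y, `|f x - f y| <= q * `|x - y|) ->
  exists p, forall x, x = f x <-> x = p.
Proof.
move=> q1 fq.
(* A contraction constant has to be nonnegative, which is not assumed of [q]. *)
have q0 : 0 <= Num.max q 0 by rewrite le_max lexx orbT.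
have fun_f : set_fun setT setT f by [].
pose F : {fun [set: V] >-> [set: V]} := HB.pack f (isFun.Build _ _ _ _ _ fun_f).
have cF : is_contraction F.
  exists (NngNum q0); split => [|[x y] _ /=].
    by rewrite /= gt_max q1 ltr01.
  by rewrite (le_trans (fq x y))// ler_wpM2r// le_max lexx.
have [p _ pF] := banach_fixed_point cF closedT (ex_intro _ point I).
exists p => x; split => [xF|->//].
exact: (contraction_fixpoint_unique cF).
Qed.

(** Put [w = g (v + y) - g y]. Since [D] undoes ['d f (g y)], the error [w - D v] is minus the image
    under [D] of the first-order remainder of [f] at [w]. That remainder is o(w), hence o(v) by the
    Lipschitz bound on [g]. *)
Lemma diff_right_inverse (R : realType) (V W : normedModType R)
    (f : V -> W) (g : W -> V)
    (C : R) (D : {linear W -> V}) (y : W) :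
  (forall z, f (g z) = z) -> (forall z, `|g z - g y| <= C * `|z - y|) ->
  differentiable f (g y) -> continuous D -> (forall v, D ('d f (g y) v) = v) ->
  is_diff y g D.
Proof.
move=> fg gC dfg Dcont Dl.
have [k k0 Dk] := linear_lipschitz Dcont.
have C1 : 0 < `|C| + 1 by rewrite ltr_wpDl.
have gE : g \o shift y = cst (g y) + (D : W -> V) +o_ 0 id.
  apply/eqaddoP => _/posnumP[e].
  have /eqaddoP : f \o shift (g y) = cst (f (g y)) + 'd f (g y) +o_ 0 id.
    exact: diff_locally.
  (* Chosen so that [k * (e' * (|C| + 1))] equals the target [e]: one factor for [D], one for
     passing from [w] to [v]. *)
  pose e' := e%:num / (k * (`|C| + 1)).
  have e'0 : 0 < e' by rewrite divr_gt0// mulr_gt0.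
  move=> /(_ e' e'0) /nbhs_ballP[d /= d0 fd].
  apply/nbhs_ballP; exists (d / (`|C| + 1)) => /=; first by rewrite divr_gt0.
  move=> v; rewrite -ball_normE /= sub0r normrN ltr_pdivlMr// => vd.
  set w := g (v + y) - g y.
  have wv : `|w| <= (`|C| + 1) * `|v|.
    rewrite (le_trans (gC _))// addrK ler_wpM2r//.
    by rewrite (le_trans (ler_norm _))// lerDl.
  have := fd w; rewrite -ball_normE /= sub0r normrN => /(_ _)/wrap[].
    by rewrite (le_lt_trans wv)// mulrC.
  rewrite /= !fctE /= subrK !fg => fw.
  have -> : g (v + y) - (g y + D v) = - D (v + y - (y + 'd f (g y) w)).
    by rewrite addrKA linearB /= Dl opprB /w opprD addrA.
  rewrite normrN (le_trans (Dk _))//.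
  rewrite (le_trans (ler_wpM2l _ fw))//; first exact: ltW.
  rewrite (le_trans (ler_wpM2l _ (ler_wpM2l _ wv)))//; [exact: ltW|exact: ltW|].
  rewrite /e' le_eqVlt; apply/orP; left; apply/eqP.
  by field; rewrite !gt_eqF.
apply: DiffDef; last exact: diff_unique.
by apply/diff_locallyP; rewrite (diff_unique Dcont gE).
Qed.

(** * Determinants of 2 by 2 matrices *)

Lemma det_mx22 (R : comNzRingType) (A : 'M[R]_2) :
  \det A = A 0 0 * A 1 1 - A 0 1 * A 1 0.
Proof.
rewrite (expand_det_row _ 0) !big_ord_recl big_ord0 addr0 /cofactor.
rewrite !det_mx11 !mxE.
rewrite /= expr0 mul1r expr1 mulN1r mulrN.
by congr (_ * A _ _ - A _ _ * A _ _); apply/val_inj.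
Qed.

Lemma det_1addZ_mx22 (R : comNzRingType) (s : R) (A : 'M[R]_2) :
  \det (1%:M + s *: A) = 1 + s * \tr A + s ^+ 2 * \det A.
Proof.
rewrite !det_mx22 /mxtrace !big_ord_recl big_ord0 !mxE /=.
have -> : lift ord0 (ord0 : 'I_1) = 1 by apply/val_inj.
ring.
Qed.

Lemma det_cayley_mx22_le (R : realFieldType) (s : R) (A : 'M[R]_2) :
  0 <= s -> \tr A <= 0 -> s ^+ 2 * `|\det A| < 1 ->
  0 < \det (1%:M - s *: A) /\
  `|\det (1%:M + s *: A)| <= \det (1%:M - s *: A).
Proof.
move=> s0 tA dA.
have sd : `|s ^+ 2 * \det A| < 1 by rewrite normrM ger0_norm// sqr_ge0.
rewrite -scaleNr !det_1addZ_mx22 sqrrN mulNr.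
have st : s * \tr A <= 0 by rewrite mulr_ge0_le0.
move: sd; rewrite ltr_norml => /andP[sd1 sd2].
by split; [|rewrite ler_norml; apply/andP; split]; lra.
Qed.

Lemma norm_det_mx22_le (R : realDomainType) (A : 'M[R]_2) (K : R) :
  (forall i j, `|A i j| <= K) -> `|\det A| <= 2 * K ^+ 2.
Proof.
move=> AK; rewrite det_mx22 (le_trans (ler_normB _ _))// !normrM.
by rewrite mulr_natl mulr2n expr2 lerD// ler_pM.
Qed.

(** * Solvability, differentiability and determinant bound for the midpoint rule *)

Theorem proposition3 (R : realType) :
  contractive_integrator (@midpoint_rule R 2).
Proof.
move=> N normN L L0.
have [c c0 cN] := matrix_norm_entry_bound normN.
pose K := c * L; have K0 : 0 < K by rewrite mulr_gt0.
(* [K] bounds the Jacobian entries, so [2 * K] is a Lipschitz constant of [f] in dimension 2, and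
   [h < K^-1] makes the contraction factor [s * (2 * K) = h * K] less than 1. *)
exists K^-1; split => [|h h0 hK f [df _] fL ftr]; first by rewrite invr_gt0.
pose s := h / 2.
have s0 : 0 < s by rewrite divr_gt0.
have q1 : s * (2 * K) < 1.
  by rewrite /s mulrA divfK// -ltr_pdivlMr// mul1r.
have JK x i j : `|jacobian f x i j| <= K.
  have := cN (Dmx f x) j i; rewrite /Dmx mxE => /le_trans; apply.
  by rewrite ler_pM2l//; exact/ltW/fL.
have flip x y : `|f x - f y| <= 2 * K * `|x - y|.
  apply: lipschitz_jacobian_bound => // z.
  exact: mx_norm_le (ltW K0) (JK z).
have /choice[k kP] :
    forall x : 'rV[R]_2, exists y, forall u, u = x + s *: f u <-> u = y.
  move=> x; pose F u := x + s *: f u.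
  apply: (contraction_unique_fixpoint (f := F) q1).
  move=> u v; rewrite /F opprD addrACA subrr add0r -scalerBr.
  rewrite normrZ gtr0_norm//.
  by rewrite -[leRHS]mulrA ler_pM2l.
have kE x : k x = x + s *: f (k x) by apply/kP.
(* Subtracting the two fixed-point equations leaves [s * (2 * K)] times the left-hand side on the
   right, where it is absorbed. *)
have klip x y : `|k x - k y| <= (1 - s * (2 * K))^-1 * `|x - y|.
  rewrite ler_pdivlMl ?subr_gt0// mulrBl mul1r lerBlDr.
  rewrite {1}(kE x) {1}(kE y) opprD addrACA -scalerBr.
  rewrite (le_trans (ler_normD _ _))// lerD2l normrZ gtr0_norm//.
  by rewrite -[leRHS]mulrA ler_pM2l.
pose M x := 1%:M - s *: jacobian f (k x).
have detM x : 0 < \det (M x) /\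
    `|\det (1%:M + s *: jacobian f (k x))| <= \det (M x).
  apply: det_cayley_mx22_le; first exact: ltW.
    by rewrite -mxtrace_tr; exact: ftr.
  rewrite (le_lt_trans (ler_wpM2l (sqr_ge0 s) (norm_det_mx22_le (JK _))))//.
  have q0 : 0 <= s * (2 * K) by rewrite !mulr_ge0// ltW.
  (* The bound on [s ^+ 2 * |det J|] is half the square of the contraction factor, so the same step
     restriction suffices. *)
  have -> : s ^+ 2 * (2 * K ^+ 2) = (s * (2 * K)) * (s * (2 * K)) / 2 by field.
  have := mulr_ile1 q0 q0 (ltW q1) (ltW q1); lra.
have Munit x : M x \in unitmx.
  by rewrite unitmxE unitfE gt_eqF//; case: (detM x).
have dk x : is_diff x k (mulmxr (invmx (M x))).
  have dfk : is_diff (k x) f ('d f (k x)) by exact: differentiableP.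
  have dF : is_diff (k x) (id - s *: f) (id - s *: ('d f (k x) : _ -> _)).
    exact: is_diffB.
  apply: (diff_right_inverse (f := id - s *: f)
                             (C := (1 - s * (2 * K))^-1)) => [z|z|||v].
  - by rewrite !fctE {1}kE addrK.
  - exact: klip.
  - exact: ex_diff.
  - exact: mulmxr_continuous.
  - have -> : 'd (id - s *: f) (k x) v = v *m M x.
      rewrite diff_val !fctE -deriveE// deriveEjacobian//.
      by rewrite /M mulmxBr mulmx1 scalemxAr.
    by rewrite /= mulmxK.
(* [k x] is to be the midpoint of [x] and [g x]. *)
pose g x := 2 *: k x - x.
have dg x : is_diff x g (mulmxr (2 *: invmx (M x) - 1%:M)).
  have -> : g = 2 *: k - id by [].
  apply: is_diff_eq; apply/funext => v.
  by rewrite !fctE /= mulmxBr mulmx1 scalemxAr.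
exists g; split; first split => [x y|x].
- rewrite /midpoint_rule; split=> [yE|->].
    (* As [h = 2 s], the midpoint of [x] and [y] solves the fixed-point equation, and uniqueness
       identifies it with [k x]. *)
    rewrite /g; have <- : 2^-1 *: (x + y) = k x.
      by apply/kP; rewrite [in LHS]yE; apply/rowP => i; rewrite !mxE /s; field.
    by apply/rowP => i; rewrite !mxE; field.
  have -> : 2^-1 *: (x + g x) = k x by apply/rowP => i; rewrite !mxE; field.
  by rewrite /g {1}kE; apply/rowP => i; rewrite !mxE /s; field.
- exact: ex_diff.
- move=> x; rewrite /Dmx det_tr.
  have -> : jacobian g x = 2 *: invmx (M x) - 1%:M.
    apply/row_matrixP => i; rewrite !rowE mul_rV_lin1.
    by rewrite (@diff_val _ _ _ _ _ _ _ (dg x)).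
  have [Mgt0 Mle] := detM x.
  (* Multiplying by the positive [\det (M x)] removes the inverse:
     [(2 M^-1 - 1) M = 2 - M = 1 + s J]. *)
  rewrite -(ler_pM2r Mgt0) mul1r -{1}(gtr0_norm Mgt0) -normrM -det_mulmx.
  rewrite mulmxBl -scalemxAl mulVmx// mul1mx.
  rewrite (_ : _ - M x = 1%:M + s *: jacobian f (k x))//.
  by rewrite /M scaler_nat mulr2n opprB addrC addrA subrK addrC.
Qed.
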